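(* For a solution $(X,r)$, $r(x,y)=(\sigma_x(y),\tau_y(x))$, consider the smallest equivalence relation $\bumpeq$ on $X$ such that $x\bumpeq\sigma_x(y)$ for all $x,y\in X$ satisfying $y=\tau_y(x)$. Then $r$ induces a biquandle structure $r'$ on $X/\!\bumpeq$. Moreover, the quotient map $X\twoheadrightarrow X/\!\bumpeq$ induces a group isomorphism $G_{(X,r)}\to G_{(X/\bumpeq,\,r')}$.
   Context: A solution $(X,r)$ is a finite set $X$ with a bijection $r\colon X\times X\to X\times X$, $r(x,y)=(\sigma_x(y),\tau_y(x))$, satisfying the Yang--Baxter equation $r_1r_2r_1=r_2r_1r_2$ on $X^3$ ($r_1=r\times \mathrm{Id}_X$, $r_2=\mathrm{Id}_X\times r$), with all maps $\sigma_x,\tau_x\colon X\to X$ bijective. A biquandle is a solution for which there is a bijection $t\colon X\to X$ with $r(t(x),x)=(t(x),x)$ for all $x\in X$. The structure group is $G_{(X,r)}=\langle X \mid xy=\sigma_x(y)\tau_y(x),\ x,y\in X\rangle$. That $r$ induces $r'$ on the quotient means that $r'([x],[y])=([\sigma_x(y)],[\tau_y(x)])$ is well defined. *)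

(* Defs.v *)
From HB Require Import structures.
From Stdlib Require Import Relation_Operators.
From mathcomp Require Import all_boot boolp.

Set Implicit Arguments.
Unset Strict Implicit.
Unset Printing Implicit Defensive.

Local Open Scope quotient_scope.

(* The group with generators T and relations u = v for (u, v) in rels, built as
   the quotient of the words in signed letters by the least congruence that
   contains rels and cancels inverse letters. *)
Section Presentation.
Variable T : choiceType.

(* (x, true) stands for x and (x, false) for x^-1. *)
Local Notation word := (seq (T * bool)).

Definition letter (x : T) : T * bool := (x, true).

Definition inv_word (u : word) : word := rev [seq (l.1, ~~ l.2) | l <- u].

Variable rels : word -> word -> Prop.

Inductive word_cong : word -> word -> Prop :=
| cong_rel u v of rels u v : word_cong u v
| cong_cancel x b : word_cong [:: (x, b); (x, ~~ b)] [::]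
| cong_refl u : word_cong u u
| cong_sym u v of word_cong u v : word_cong v u
| cong_trans v u w of word_cong u v & word_cong v w : word_cong u w
| cong_cat u u' v v' of word_cong u u' & word_cong v v' :
    word_cong (u ++ v) (u' ++ v').

Definition word_eq : rel word := fun u v => `[< word_cong u v >].

Lemma word_eq_refl : reflexive word_eq.
Proof. by move=> u; apply/asboolP; exact: cong_refl. Qed.

Lemma word_eq_sym : symmetric word_eq.
Proof. by move=> u v; apply/asboolP/asboolP; exact: cong_sym. Qed.

Lemma word_eq_trans : transitive word_eq.
Proof.
by move=> v u w /asboolP uv /asboolP vw; apply/asboolP; exact: cong_trans uv vw.
Qed.

Canonical word_equiv := EquivRel word_eq word_eq_refl word_eq_sym word_eq_trans.

Definition presented : Type := {eq_quot word_equiv}.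
HB.instance Definition _ := Choice.on presented.

Definition word_class : seq (T * bool) -> presented :=
  \pi_{eq_quot word_equiv}.
Definition word_repr : presented -> seq (T * bool) :=
  repr : {eq_quot word_equiv} -> _.

Definition pres_gen (x : T) : presented := word_class [:: letter x].
Definition pres_one : presented := word_class [::].
Definition pres_inv (a : presented) : presented :=
  word_class (inv_word (word_repr a)).
Definition pres_mul (a b : presented) : presented :=
  word_class (word_repr a ++ word_repr b).

Lemma word_reprK : cancel word_repr word_class.
Proof. exact: (@reprK _ {eq_quot word_equiv}). Qed.

Lemma word_classP a : exists u, a = word_class u.
Proof. by exists (word_repr a); rewrite word_reprK. Qed.

Lemma word_congP u v :
  word_class u = word_class v <-> word_cong u v.
Proof.
by split=> [/eqmodP/asboolP // | uv]; apply/eqmodP/asboolP.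
Qed.

Lemma cong_repr u : word_cong (word_repr (word_class u)) u.
Proof. by apply/word_congP; rewrite word_reprK. Qed.

Lemma word_classM u v :
  pres_mul (word_class u) (word_class v) = word_class (u ++ v).
Proof. by apply/word_congP/cong_cat; exact: cong_repr. Qed.

Lemma cong_mulV u : word_cong (u ++ inv_word u) [::].
Proof.
elim: u => [|[x b] u IH]; first exact: cong_refl.
have -> : ((x, b) :: u) ++ inv_word ((x, b) :: u) =
    [:: (x, b)] ++ (u ++ inv_word u) ++ [:: (x, ~~ b)].
  by rewrite /inv_word /= rev_cons -cats1 catA.
apply: cong_trans (cong_cancel x b).
exact: (cong_cat (cong_refl [:: (x, b)]) (cong_cat IH (cong_refl _))).
Qed.

Lemma inv_wordK : involutive inv_word.
Proof.
move=> u; rewrite /inv_word map_rev revK -map_comp -[RHS]map_id.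
by apply: eq_map => -[x b] /=; rewrite negbK.
Qed.

Lemma pres_mulA : associative pres_mul.
Proof.
move=> a b c.
case: (word_classP a) (word_classP b) (word_classP c) => u -> [v ->] [w ->].
by rewrite (word_classM v w) (word_classM u v) (word_classM u)
  (word_classM _ w) catA.
Qed.

Lemma pres_mul1 : left_id pres_one pres_mul.
Proof. by move=> a; case: (word_classP a) => u ->; rewrite word_classM. Qed.

Lemma pres_mulr1 : right_id pres_one pres_mul.
Proof.
by move=> a; case: (word_classP a) => u ->; rewrite word_classM cats0.
Qed.

Lemma pres_mulrV : right_inverse pres_one pres_inv pres_mul.
Proof.
move=> a; rewrite -{1}[a]word_reprK word_classM; apply/word_congP.
exact: cong_mulV.
Qed.

Lemma pres_mulV : left_inverse pres_one pres_inv pres_mul.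
Proof.
move=> a; rewrite -{2}[a]word_reprK word_classM; apply/word_congP.
by rewrite -{2}[word_repr a]inv_wordK; exact: cong_mulV.
Qed.

HB.instance Definition _ := isGroup.Build presented
  pres_mulA pres_mul1 pres_mulr1 pres_mulV pres_mulrV.

End Presentation.

Section Solutions.
Variables (X : finType) (r : X * X -> X * X).

(* r (x, y) = (sigma x y, tau y x); the subscript comes first. *)
Definition sigma (x y : X) : X := (r (x, y)).1.
Definition tau (y x : X) : X := (r (x, y)).2.

Definition r1 (p : X * X * X) : X * X * X := (r p.1, p.2).
Definition r2 (p : X * X * X) : X * X * X :=
  let q := r (p.1.2, p.2) in (p.1.1, q.1, q.2).

Record is_solution : Prop := {
  solution_bij : bijective r;
  solution_ybe : r1 \o r2 \o r1 =1 r2 \o r1 \o r2;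
  solution_sigma_bij : forall x, bijective (sigma x);
  solution_tau_bij : forall y, bijective (tau y)
}.

Record is_biquandle : Prop := {
  biquandle_solution : is_solution;
  biquandle_twist :
    exists2 t : X -> X, bijective t & forall x, r (t x, x) = (t x, x)
}.

Definition struct_rels (u v : seq (X * bool)) : Prop :=
  exists x y : X, u = [:: letter x; letter y] /\
                  v = [:: letter (sigma x y); letter (tau y x)].

Definition struct_group : Type := presented struct_rels.
HB.instance Definition _ := Group.on struct_group.

Definition struct_gen (x : X) : struct_group := pres_gen struct_rels x.

Definition bumpeq_step (x z : X) : Prop :=
  exists2 y, y = tau y x & z = sigma x y.

Definition bumpeq : rel X :=
  fun x z => `[< clos_refl_sym_trans X bumpeq_step x z >].

Lemma bumpeq_refl : reflexive bumpeq.
Proof. by move=> x; apply/asboolP; exact: rst_refl. Qed.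

Lemma bumpeq_sym : symmetric bumpeq.
Proof. by move=> x y; apply/asboolP/asboolP; exact: rst_sym. Qed.

Lemma bumpeq_trans : transitive bumpeq.
Proof.
by move=> y x z /asboolP xy /asboolP yz; apply/asboolP; exact: rst_trans xy yz.
Qed.

Canonical bumpeq_equiv := EquivRel bumpeq bumpeq_refl bumpeq_sym bumpeq_trans.

Definition bumpeq_quot : Type := {eq_quot bumpeq_equiv}.
HB.instance Definition _ := Quotient.on bumpeq_quot.
HB.instance Definition _ := [Finite of bumpeq_quot by <:%/].

Definition bumpeq_pi (x : X) : bumpeq_quot := \pi_{eq_quot bumpeq_equiv} x.

End Solutions.

(* Main.v *)
From HB Require Import structures.
Require Import Defs.
From Stdlib Require Import Relation_Operators.
From mathcomp Require Import all_boot boolp.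

(** Call a step a pair (x, z) with r (x, y) = (z, y) for some y, so that the
    relation is generated by the steps.  Everything follows from the three
    component identities of the Yang-Baxter equation, applied to triples that
    contain (x, y).

    The map induced by r is well defined.  The identities for sigma and for tau,
    with sigma and tau bijective, give sigma x = sigma z and tau x = tau z
    ([step_sigma], [step_tau]): the action of an element does not change along
    a step.  Conversely the actions carry steps to steps ([sigma_step],
    [tau_step]): moving an extra element past x y = z y on either side gives an
    equality of the same form.

    The quotient is a biquandle.  It inherits the Yang-Baxter equation, and its
    maps are surjective because they lift to surjective maps, hence bijective by
    finiteness.  Put t y = tau y ^-1 y.  On X, r (t y, y) = (z, y) where (t y, z)
    is a step, so r' (t y, y) = (t y, y) between classes.  There y is the preimage
    of t y under the bijection sigma (t y), so t y determines y: t is injective,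
    hence bijective.

    The structure groups agree.  The relation x y = z y of the structure group
    cancels to x = z, so related elements are equal as generators
    ([struct_gen_step]).  Hence both the quotient map and any choice of
    representatives send relations to consequences of relations, and they are
    mutually inverse on generators, which is enough for an isomorphism
    ([presented_iso]). *)

Set Implicit Arguments.
Unset Strict Implicit.
Unset Printing Implicit Defensive.

Local Open Scope quotient_scope.

(** * Morphisms between presented groups *)

Definition word_map (T T' : Type) (h : T -> T') (u : seq (T * bool)) :
  seq (T' * bool) := [seq (h l.1, l.2) | l <- u].

Lemma word_cong_map (T T' : choiceType) (h : T -> T')
    (rels : seq (T * bool) -> seq (T * bool) -> Prop)
    (rels' : seq (T' * bool) -> seq (T' * bool) -> Prop) :
  (forall u v, rels u v -> word_cong rels' (word_map h u) (word_map h v)) ->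
  forall u v, word_cong rels u v ->
    word_cong rels' (word_map h u) (word_map h v).
Proof.
move=> hrel u v; elim=> {u v} [u v /hrel // |x b|u|u v _ |v u w _ uv _ vw|].
- exact: cong_cancel.
- exact: cong_refl.
- exact: cong_sym.
- exact: cong_trans uv vw.
- by move=> u u' v v' _ uu' _ vv'; rewrite /word_map !map_cat; exact: cong_cat.
Qed.

Lemma word_cong_cancelr (T : choiceType)
    (rels : seq (T * bool) -> seq (T * bool) -> Prop) u v l :
  word_cong rels (u ++ [:: l]) (v ++ [:: l]) -> word_cong rels u v.
Proof.
case: l => x b uv.
have K w : word_cong rels ((w ++ [:: (x, b)]) ++ [:: (x, ~~ b)]) w.
  rewrite -catA -{2}[w]cats0.
  exact: cong_cat (cong_refl _ _) (cong_cancel _ _ _).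
exact: cong_trans (cong_sym (K u))
  (cong_trans (cong_cat uv (cong_refl _ _)) (K v)).
Qed.

Lemma word_cong_letter (T : choiceType)
    (rels : seq (T * bool) -> seq (T * bool) -> Prop) x z b :
  word_cong rels [:: letter x] [:: letter z] ->
  word_cong rels [:: (x, b)] [:: (z, b)].
Proof.
case: b => // xz.
(* x^-1 = z^-1 is obtained by cancelling x from x^-1 x = z^-1 x *)
apply: (@word_cong_cancelr _ _ _ _ (letter x)).
apply: cong_trans (cong_cancel _ x false) _; apply: cong_sym.
apply: cong_trans (cong_cancel _ z false).
exact: cong_cat (cong_refl _ [:: (z, false)]) xz.
Qed.

Lemma word_cong_map_id (T : choiceType)
    (rels : seq (T * bool) -> seq (T * bool) -> Prop) (h : T -> T) :
  (forall x, word_cong rels [:: letter (h x)] [:: letter x]) ->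
  forall u, word_cong rels (word_map h u) u.
Proof.
move=> hid; elim=> [|[x b] u IHu]; first exact: cong_refl.
exact: cong_cat (word_cong_letter b (hid x)) IHu.
Qed.

(** Maps on generators suffice: that they respect the relations gives morphisms
    in both directions, and that they are inverse on generators makes the
    morphisms inverse. *)
Lemma presented_iso (T T' : choiceType) (h : T -> T') (g : T' -> T)
    (rels : seq (T * bool) -> seq (T * bool) -> Prop)
    (rels' : seq (T' * bool) -> seq (T' * bool) -> Prop) :
  (forall u v, rels u v -> word_cong rels' (word_map h u) (word_map h v)) ->
  (forall u v, rels' u v -> word_cong rels (word_map g u) (word_map g v)) ->
  (forall x, word_cong rels [:: letter (g (h x))] [:: letter x]) ->
  (forall x, word_cong rels' [:: letter (h (g x))] [:: letter x]) ->
  exists f : {multiplicative presented rels -> presented rels'},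
    (forall x, f (pres_gen rels x) = pres_gen rels' (h x)) /\ bijective f.
Proof.
move=> /word_cong_map hcong /word_cong_map gcong ghid hgid.
pose f (a : presented rels) : presented rels' :=
  word_class rels' (word_map h (word_repr a)).
pose f' (a : presented rels') : presented rels :=
  word_class rels (word_map g (word_repr a)).
have fE u : f (word_class rels u) = word_class rels' (word_map h u).
  by apply/word_congP/hcong/cong_repr.
have f'E u : f' (word_class rels' u) = word_class rels (word_map g u).
  by apply/word_congP/gcong/cong_repr.
have fM : {morph f : a b / (a * b)%g}.
  move=> a b; case: (word_classP a) (word_classP b) => u -> [v ->].
  by rewrite [LHS](congr1 f (word_classM _ u v)) !fE /word_map map_cat
    [RHS]word_classM.
pose fmul := isMultiplicative.Build _ _ f fM.
pose F : {multiplicative presented rels -> presented rels'} :=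
  HB.pack f fmul.
exists F; split=> [x|]; first exact: fE.
exists f' => a; case: (word_classP a) => u ->.
- rewrite [LHS](congr1 f' (fE u)) f'E /word_map -map_comp.
  exact/word_congP/(word_cong_map_id ghid).
- rewrite f'E [LHS]fE /word_map -map_comp.
  exact/word_congP/(word_cong_map_id hgid).
Qed.

(** * The Yang-Baxter equation in components *)

Section Solution.
Variables (X : finType) (r : X * X -> X * X).
Local Notation sigma := (sigma r).
Local Notation tau := (tau r).

Lemma ybe_components :
  (r1 r \o r2 r \o r1 r =1 r2 r \o r1 r \o r2 r) <->
  (forall x y z,
    [/\ sigma x (sigma y z) = sigma (sigma x y) (sigma (tau y x) z),
        tau (sigma (tau y x) z) (sigma x y) =
          sigma (tau (sigma y z) x) (tau z y)
      & tau z (tau y x) = tau (tau z y) (tau (sigma y z) x)]).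
Proof.
have rE x y : r (x, y) = (sigma x y, tau y x) by rewrite -surjective_pairing.
have lE x y z : (r1 r \o r2 r \o r1 r) (x, y, z) =
    (sigma (sigma x y) (sigma (tau y x) z),
     tau (sigma (tau y x) z) (sigma x y), tau z (tau y x)).
  by rewrite /= /r1 /r2 !rE.
have eE x y z : (r2 r \o r1 r \o r2 r) (x, y, z) =
    (sigma x (sigma y z), sigma (tau (sigma y z) x) (tau z y),
     tau (tau z y) (tau (sigma y z) x)).
  by rewrite /= /r1 /r2 !rE.
split=> [ybe x y z|comp [[x y] z]].
  by have := ybe (x, y, z); rewrite lE eE => -[<- <- <-].
by rewrite lE eE; have [-> -> ->] := comp x y z.
Qed.

(** * Steps and the actions *)

Hypothesis solr : is_solution r.

Let ybe := (ybe_components.1 (solution_ybe solr)).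
Let tau_inj x : injective (tau x) := bij_inj (solution_tau_bij solr x).

(** From r (x, y) = (z, y), the identity for sigma reads
    sigma x \o sigma y = sigma z \o sigma y, and sigma y is surjective. *)
Lemma step_sigma x z w : bumpeq_step r x z -> sigma x w = sigma z w.
Proof.
case=> y yE ->; have [k _ kK] := solution_sigma_bij solr y.
by have [] := ybe x y (k w); rewrite -yE kK.
Qed.

(** Dually, tau y \o tau x = tau y \o tau z, and tau y is injective. *)
Lemma step_tau x z w : bumpeq_step r x z -> tau x w = tau z w.
Proof.
case=> y yE ->; apply: (@tau_inj y).
by have [_ _] := ybe w x y; rewrite -yE.
Qed.

(** The Yang-Baxter equation at (w, x, y) shows that the image step has the
    witness sigma (tau x w) y; its two sides agree in this witness because
    tau x = tau z. *)
Lemma sigma_step w x z :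
  bumpeq_step r x z -> bumpeq_step r (sigma w x) (sigma w z).
Proof.
move=> xz; have txz := step_tau w xz; case: xz => y yE zE.
have [s_s mixed _] := ybe w x y.
by exists (sigma (tau x w) y); [rewrite mixed -yE -zE txz | rewrite zE].
Qed.

(** The Yang-Baxter equation at (x, y, w') shows how tau (sigma y w') acts on
    the step, with witness tau w' y; every w is some sigma y w'. *)
Lemma tau_step w x z :
  bumpeq_step r x z -> bumpeq_step r (tau w x) (tau w z).
Proof.
case=> y yE ->; have [k _ kK] := solution_sigma_bij solr y.
have [_ mixed t_t] := ybe x y (k w); rewrite -yE kK in mixed t_t.
by exists (tau (k w) y).
Qed.

(** If r (x, y) = (z, y), the relation x y = z y holds in the structure group,
    and y cancels. *)
Lemma struct_gen_step x z :
  bumpeq_step r x z -> struct_gen r x = struct_gen r z.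
Proof.
case=> y yE ->; apply/word_congP.
apply: (@word_cong_cancelr _ _ _ _ (letter y)); apply: cong_rel.
by exists x, y; rewrite -yE.
Qed.

(** * The induced map on the quotient *)

Local Notation pi := (bumpeq_pi r).

Lemma bumpeq_pi_surj q : exists x, pi x = q.
Proof. by exists (repr q); exact: reprK. Qed.

Lemma bumpeq_pi_step x z : bumpeq_step r x z -> pi x = pi z.
Proof. by move=> xz; apply/eqmodP/asboolP; exact: rst_step. Qed.

(** The universal property of the quotient: the generated relation never has to
    be inspected beyond its steps. *)
Lemma bumpeq_pi_factor (U : Type) (f : X -> U) :
  (forall x z, bumpeq_step r x z -> f x = f z) ->
  forall x z, pi x = pi z -> f x = f z.
Proof.
move=> fstep x z /eqmodP/asboolP.
by elim=> {x z} [||x z _ ->|x y z _ -> _ ->] //; exact: fstep.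
Qed.

Lemma bumpeq_pi_sigma x x' y y' :
  pi x = pi x' -> pi y = pi y' -> pi (sigma x y) = pi (sigma x' y').
Proof.
move=> xx' yy'.
rewrite (bumpeq_pi_factor (f := sigma^~ y) _ xx'); last first.
  by move=> ? ?; exact: step_sigma.
apply: (bumpeq_pi_factor (f := pi \o sigma x') _ yy') => ? ? /= st.
exact: bumpeq_pi_step (sigma_step _ st).
Qed.

Lemma bumpeq_pi_tau x x' y y' :
  pi x = pi x' -> pi y = pi y' -> pi (tau x y) = pi (tau x' y').
Proof.
move=> xx' yy'.
rewrite (bumpeq_pi_factor (f := tau^~ y) _ xx'); last first.
  by move=> ? ?; exact: step_tau.
apply: (bumpeq_pi_factor (f := pi \o tau x') _ yy') => ? ? /= st.
exact: bumpeq_pi_step (tau_step _ st).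
Qed.

Definition bumpeq_map (p : bumpeq_quot r * bumpeq_quot r) :
    bumpeq_quot r * bumpeq_quot r :=
  (pi (sigma (repr p.1) (repr p.2)), pi (tau (repr p.2) (repr p.1))).

Lemma bumpeq_mapE x y :
  bumpeq_map (pi x, pi y) = (pi (sigma x y), pi (tau y x)).
Proof.
have reprP w : pi (repr (pi w)) = pi w by exact: reprK.
by congr pair; [apply: bumpeq_pi_sigma | apply: bumpeq_pi_tau]; exact: reprP.
Qed.

End Solution.

Arguments bumpeq_map {X} r p.

(** * The biquandle and its structure group *)

Lemma surj_bij (T : finType) (f : T -> T) :
  (forall y, exists x, f x = y) -> bijective f.
Proof.
move=> fsurj; have [g gK] := choice fsurj.
have [h hK gh] := injF_bij (can_inj gK).
by exists g => // x; rewrite -{1}[x]gh gK gh.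
Qed.

Section Quotient.
Variables (X : finType) (r : X * X -> X * X).
Hypothesis solr : is_solution r.
Local Notation pi := (bumpeq_pi r).
Local Notation r' := (bumpeq_map r).

Let sigmaE x y : sigma r' (pi x) (pi y) = pi (sigma r x y).
Proof. by rewrite /sigma bumpeq_mapE. Qed.

Let tauE x y : tau r' (pi x) (pi y) = pi (tau r x y).
Proof. by rewrite /tau bumpeq_mapE. Qed.

Lemma bumpeq_map_solution : is_solution r'.
Proof.
split.
- apply: surj_bij => -[p q].
  have [[x <-] [y <-]] := (bumpeq_pi_surj p, bumpeq_pi_surj q).
  have [k _ kK] := solution_bij solr.
  exists (pi (k (x, y)).1, pi (k (x, y)).2).
  by rewrite bumpeq_mapE // /sigma /tau -surjective_pairing kK.
- apply/ybe_components => p q s.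
  have [x <-] := bumpeq_pi_surj p; have [y <-] := bumpeq_pi_surj q.
  have [z <-] := bumpeq_pi_surj s; rewrite !(sigmaE, tauE).
  by have [-> -> ->] := (ybe_components r).1 (solution_ybe solr) x y z.
- move=> p; have [x <-] := bumpeq_pi_surj p; apply: surj_bij => q.
  have [y <-] := bumpeq_pi_surj q; have [k _ kK] := solution_sigma_bij solr x.
  by exists (pi (k y)); rewrite sigmaE kK.
- move=> p; have [x <-] := bumpeq_pi_surj p; apply: surj_bij => q.
  have [y <-] := bumpeq_pi_surj q; have [k _ kK] := solution_tau_bij solr x.
  by exists (pi (k y)); rewrite tauE kK.
Qed.

(** For q the class of y, the class p is that of x = tau y ^-1 y: the pair
    (x, sigma x y) is a step by definition. *)
Lemma bumpeq_map_twist q : exists p, r' (p, q) = (p, q).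
Proof.
have [y <-] := bumpeq_pi_surj q.
have [k _ /(_ y) kK] := solution_tau_bij solr y.
exists (pi (k y)); rewrite bumpeq_mapE // kK; congr pair.
by apply/esym/bumpeq_pi_step; exists y.
Qed.

(** Injectivity of t: q is the only preimage of t q under sigma (t q). *)
Lemma bumpeq_map_biquandle : is_biquandle r'.
Proof.
split; first exact: bumpeq_map_solution.
have [t tE] := choice bumpeq_map_twist; exists t => //; apply: injF_bij.
have sE q : sigma r' (t q) q = t q by rewrite /sigma tE.
move=> q q' eqt.
apply: (bij_inj (solution_sigma_bij bumpeq_map_solution (t q))).
by rewrite sE {2}eqt sE.
Qed.

Lemma bumpeq_map_struct_iso :
  exists f : {multiplicative struct_group r -> struct_group r'},
    (forall x, f (struct_gen r x) = struct_gen r' (pi x)) /\ bijective f.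
Proof.
have reprP w : pi (repr (pi w)) = pi w by exact: reprK.
have gen_repr x :
    word_cong (struct_rels r) [:: letter (repr (pi x))] [:: letter x].
  apply/word_congP; apply: (bumpeq_pi_factor (f := struct_gen r) _ (reprP x)).
  by move=> ? ?; exact: struct_gen_step.
apply: (@presented_iso X (bumpeq_quot r) pi repr (struct_rels r)
  (struct_rels r')) => [u v|u v|x|q].
- case=> x [y [-> ->]]; apply: cong_rel.
  by exists (pi x), (pi y); rewrite sigmaE tauE.
- case=> p [q [-> ->]]; have [x <-] := bumpeq_pi_surj p.
  have [y <-] := bumpeq_pi_surj q; rewrite sigmaE tauE.
  apply: (@cong_trans _ _ [:: letter x; letter y]).
    exact: cong_cat (gen_repr x) (gen_repr y).
  apply: (@cong_trans _ _ [:: letter (sigma r x y); letter (tau r y x)]).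
    by apply: cong_rel; exists x, y.
  exact/cong_sym/(cong_cat (gen_repr _) (gen_repr _)).
- exact: gen_repr.
- have -> : pi (repr q) = q by exact: reprK.
  exact: cong_refl.
Qed.

End Quotient.

Theorem proposition1p1 (X : finType) (r : X * X -> X * X) :
  is_solution r ->
  exists r' : bumpeq_quot r * bumpeq_quot r -> bumpeq_quot r * bumpeq_quot r,
    (forall x y : X,
       r' (bumpeq_pi r x, bumpeq_pi r y) =
       (bumpeq_pi r (sigma r x y), bumpeq_pi r (tau r y x))) /\
    is_biquandle r' /\
    exists f : {multiplicative struct_group r -> struct_group r'},
      (forall x : X, f (struct_gen r x) = struct_gen r' (bumpeq_pi r x)) /\
      bijective f.
Proof.
move=> solr; exists (bumpeq_map r); split; first exact: bumpeq_mapE.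
by split; [exact: bumpeq_map_biquandle | exact: bumpeq_map_struct_iso].
Qed.
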